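(* Let $f:\mathbb{R}\to\mathbb{R}$ and the sequence $(x_k;\alpha_k)_{k\in\mathbb{N}}$ be the objective function and the iterates of the direct-search instance defined in the context, with poll directions $d_1=-1$, $d_2=1$. Let $x_*=0$, $B_1={]}{-2},0]$, $B_2={]}0,2[$ and $K=2\mathbb{N}$ (the indices of the iterations at which the poll step fails). Then: (a) for every infinite $K'\subseteq K$ and every $k\in K'$, $x_k\in\mathrm{cl}(B_2)$ and $x_k+\alpha_kd_2\in\mathrm{int}(B_2)$; (b) there is no infinite $K'\subseteq K$ and $i\in\{1,2\}$ such that for all $k\in K'$ one has $x_k\in\mathrm{cl}(B_i)$ and $x_k+\alpha_kd_1\in\mathbb{R}\setminus\mathrm{cl}(B_i)$; indeed $x_k\notin\mathrm{cl}(B_1)$ for all $k\in\mathbb{N}$, and $x_k+\alpha_kd_1=2^{-q}\in B_2$ for all $k=2q$ with $q\in\mathbb{N}$; (c) for every infinite $K'\subseteq K$, $\lim_{k\in K'}f(x_k)=0\neq-1=f(x_* )$.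
   Context: Objective function. Let $p(x)=-18+60x-69x^2+34x^3-6x^4$ for $x\in[1,2]$, and define $f:\mathbb{R}\to\mathbb{R}$ by $f(x)=(x+1)^2-2$ if $x\le0$, and $f(x)=2^\ell\,p(x/2^\ell)$ if $x\in[2^\ell,2^{\ell+1}[$ with $\ell\in\mathbb{Z}$. The problem is the unconstrained minimization of $f$ over $\mathbb{R}$. Direct-search instance. $x_0=\frac54$, $\alpha_0=\frac14$. At iteration $k\in\mathbb{N}$: - Search step: if $k$ is even there is no search trial point; if $k$ is odd, the single trial point $t_k=x_k-5\alpha_k$ is evaluated, and if $f(t_k)<f(x_k)$ then $x_{k+1}=t_k$ and the poll step is skipped. - Poll step (if not skipped): the points $x_k+\alpha_kd$, $d\in D_k=\{-1,1\}$, are evaluated; if the one with the smallest value of $f$ has value strictly less than $f(x_k)$, it becomes $x_{k+1}$; otherwise the poll step fails and $x_{k+1}=x_k$. - Step update: $\alpha_{k+1}=\alpha_k$ if the iteration found a point strictly better than $x_k$, and $\alpha_{k+1}=\alpha_k/2$ otherwise. *)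

(* Defs.v *)
From mathcomp Require Import all_boot all_order all_algebra.
From mathcomp Require Import all_classical all_reals all_analysis.
From mathcomp Require Import ring lra.

Set Implicit Arguments.
Unset Strict Implicit.
Unset Printing Implicit Defensive.

Import Order.TTheory GRing.Theory Num.Theory.
Import numFieldNormedType.Exports.

Local Open Scope classical_set_scope.
Local Open Scope ring_scope.

Section Objective.
Context {R : realType}.
Implicit Types x y : R.

Definition p x : R := - 18 + 60 * x - 69 * x ^+ 2 + 34 * x ^+ 3 - 6 * x ^+ 4.

(* For x > 0, the unique integer l such that 2 ^ l <= x < 2 ^ (l + 1);
   see dyadic_expP. *)
Definition dyadic_exp x : int := Num.floor (ln x / ln 2).

Definition f x : R :=
  if x <= 0 then (x + 1) ^+ 2 - 2
  else 2 ^ dyadic_exp x * p (x / 2 ^ dyadic_exp x).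

Lemma dyadic_expP (l : int) x : 2 ^ l <= x < 2 ^ (l + 1) -> dyadic_exp x = l.
Proof.
move=> /andP[lex ltx].
have pow_gt0 m : 0 < (2 : R) ^ m by exact: exprz_gt0.
have ln_pow m : ln ((2 : R) ^ m) = m%:~R * ln 2.
  by rewrite -powR_intmul// ln_powR.
have x_gt0 : 0 < x := lt_le_trans (pow_gt0 l) lex.
have ln2_gt0 : 0 < ln (2 : R) by rewrite ln_gt0 ?ltr1n.
apply: floor_def; rewrite ler_pdivlMr// ltr_pdivrMr// -!ln_pow.
by rewrite ler_ln ?posrE// ltr_ln ?posrE// lex ltx.
Qed.

Lemma f_nonpos x : x <= 0 -> f x = (x + 1) ^+ 2 - 2.
Proof. by rewrite /f => ->. Qed.

Lemma f_dyadic (l : int) x :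
  2 ^ l <= x < 2 ^ (l + 1) -> f x = 2 ^ l * p (x / 2 ^ l).
Proof.
move=> hx; rewrite /f (dyadic_expP hx) leNgt.
by rewrite (lt_le_trans _ (proj1 (andP hx)))// exprz_gt0.
Qed.

End Objective.

Section DirectSearch.
Context {R : realType}.
Implicit Types x a : R.

Definition d1 : R := - 1.
Definition d2 : R := 1.
Definition poll_directions : set R := [set d1; d2].

Definition search_point x a : R := x - 5 * a.

Definition search_succeeds (k : nat) x a : Prop :=
  odd k /\ f (search_point x a) < f x.

Definition poll_fails (k : nat) x a : Prop :=
  ~ search_succeeds k x a /\
  forall d, poll_directions d -> f x <= f (x + a * d).

(* [ds_step k x a x' a'] : iteration k may lead from (x_k, alpha_k) = (x, a) to
   (x_{k+1}, alpha_{k+1}) = (x', a').  It is a relation because, when both poll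
   points attain the smallest value, either of them may be selected. *)
Inductive ds_step (k : nat) x a : R -> R -> Prop :=
| SearchSuccess : search_succeeds k x a -> ds_step k x a (search_point x a) a
| PollSuccess d : ~ search_succeeds k x a ->
    poll_directions d ->
    (forall d', poll_directions d' -> f (x + a * d) <= f (x + a * d')) ->
    f (x + a * d) < f x ->
    ds_step k x a (x + a * d) a
| PollFailure : poll_fails k x a -> ds_step k x a x (a / 2).

Definition ds_run (x alpha : nat -> R) : Prop :=
  [/\ x 0 = 5 / 4, alpha 0 = 1 / 4 &
      forall k, ds_step k (x k) (alpha k) (x k.+1) (alpha k.+1)].

Lemma ds_step_total k x a : exists s : R * R, ds_step k x a s.1 s.2.
Proof.
have [ss|nss] := pselect (search_succeeds k x a).
  by exists (search_point x a, a); exact: SearchSuccess.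
have [d Dd dmin] : exists2 d, poll_directions d &
    forall d', poll_directions d' -> f (x + a * d) <= f (x + a * d').
  have [le12|/ltW le21] := leP (f (x + a * d1)) (f (x + a * d2)).
    by exists d1; [left|move=> d' [->|->]].
  by exists d2; [right|move=> d' [->|->]].
have [ltd|led] := ltP (f (x + a * d)) (f x).
  by exists (x + a * d, a); exact: PollSuccess.
exists (x, a / 2); apply: PollFailure; split=> // d' Dd'.
exact: le_trans led (dmin _ Dd').
Qed.

Lemma ds_run_exists : exists x alpha : nat -> R, ds_run x alpha.
Proof.
have [next nextP] :=
  choice (fun s : nat * (R * R) => ds_step_total s.1 s.2.1 s.2.2).
pose s := fix s n := if n is k.+1 then next (k, s k) else (5 / 4, 1 / 4).
exists (fun n => (s n).1), (fun n => (s n).2); split=> // k.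
exact: (nextP (k, s k)).
Qed.

End DirectSearch.

Definition xstar {R : realType} : R := 0.
Definition B1 {R : realType} : set R := `]-2, 0]%classic.
Definition B2 {R : realType} : set R := `]0, 2[%classic.
Definition K : set nat := [set k | ~~ odd k].

(* Main.v *)
Require Import Defs.
From mathcomp Require Import all_boot all_order all_algebra.
From mathcomp Require Import all_classical all_reals all_analysis.
From mathcomp Require Import ring lra.

Import Order.TTheory GRing.Theory Num.Theory.
Import numFieldNormedType.Exports.

Local Open Scope classical_set_scope.
Local Open Scope ring_scope.

(** The objective satisfies [f (x / 2) = f x / 2] for [x > 0], and two
    consecutive iterations of the method reproduce the initial configuration at
    half the scale, so the run is known in closed form:
    [x_k = 5/4 * 2^-(k./2)] and [alpha_k = 1/4 * 2^-(uphalf k)]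
    (lemma [ds_run_closed_form]).  At scale 1 everything rests on the three
    values [p 1 = 1], [p (5/4) = 121/128] and [p (3/2) = 9/8]:
    - at an even iteration the poll points are [1] and [3/2], both worse than
      [5/4], so the poll fails and the step size is halved
      (lemma [poll_fails_scaled]);
    - at the following odd iteration the search point is
      [5/4 - 5/8 = (5/4) / 2], where [f] is half as large, so the search
      succeeds (lemma [search_succeeds_scaled]).
    The iterates therefore tend to 0 from the right, with
    [f x_k = 121/128 * 2^-(k./2)] tending to 0, and they never see the branch
    [x <= 0], whose value at 0 is [-1].  The claims about the closures of [B1]
    and [B2] are inequalities on the closed form. *)

Section Run.
Context {R : realType}.
Implicit Types (x a c : R) (k q : nat).

Lemma exp2N_gt0 q : 0 < (2 : R) ^- q.
Proof. by rewrite invr_gt0 exprn_gt0. Qed.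

Lemma exp2N_le1 q : (2 : R) ^- q <= 1.
Proof. by rewrite invf_le1 ?exprn_gt0// exprn_ege1// ler1n. Qed.

(** Self-similarity of the objective: [c * 2 ^- q] lies in the dyadic interval of
    exponent [- q], so every value of [f] met by the run reduces to one of [p]. *)
Lemma f_scaled q c : 1 <= c < 2 -> f (c * 2 ^- q) = 2 ^- q * p c.
Proof.
move=> /andP[c1 c2]; have h0 := exp2N_gt0 q.
have hE : (2 : R) ^ (- q%:Z) = 2 ^- q by rewrite -exprnN.
rewrite (@f_dyadic _ (- q%:Z)); last first.
  rewrite expfzDr ?pnatr_eq0// hE expr1z; apply/andP; split; nra.
by rewrite hE mulfK// gt_eqF.
Qed.

Lemma p_54 : p (5 / 4) = 121 / 128 :> R.
Proof. by rewrite /p; field. Qed.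

Lemma f_54_scaled q : f (5 / 4 * 2 ^- q) = 121 / 128 * 2 ^- q :> R.
Proof. by rewrite f_scaled ?p_54 1?mulrC//; apply/andP; split; lra. Qed.

Lemma poll_fails_scaled k q : ~~ odd k ->
  poll_fails k (5 / 4 * 2 ^- q : R) (1 / 4 * 2 ^- q).
Proof.
move=> /negP evk; split=> [[/evk]//|d Dd]; have h0 := exp2N_gt0 q.
rewrite f_54_scaled; case: Dd => ->; rewrite /d1 /d2.
- have -> : 5 / 4 * 2 ^- q + 1 / 4 * 2 ^- q * -1 = 1 * 2 ^- q :> R by field.
  rewrite f_scaled; last by apply/andP; split; lra.
  have -> : p 1 = 1 :> R by rewrite /p; field.
  lra.
- have -> : 5 / 4 * 2 ^- q + 1 / 4 * 2 ^- q * 1 = 3 / 2 * 2 ^- q :> R by field.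
  rewrite f_scaled; last by apply/andP; split; lra.
  have -> : p (3 / 2) = 9 / 8 :> R by rewrite /p; field.
  lra.
Qed.

Lemma search_point_scaled q :
  search_point (5 / 4 * 2 ^- q) (1 / 4 * 2 ^- q.+1) = 5 / 4 * 2 ^- q.+1 :> R.
Proof. by rewrite /search_point exprS invfM; field. Qed.

Lemma search_succeeds_scaled k q : odd k ->
  search_succeeds k (5 / 4 * 2 ^- q : R) (1 / 4 * 2 ^- q.+1).
Proof.
move=> oddk; split=> //; rewrite search_point_scaled !f_54_scaled exprS invfM.
have := exp2N_gt0 q; lra.
Qed.

Lemma ds_step_poll_failure k x a x' a' :
  poll_fails k x a -> ds_step k x a x' a' -> x' = x /\ a' = a / 2.
Proof.
move=> [nss fle]; case=> // d _ Dd _ flt.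
by move: (fle d Dd); rewrite leNgt flt.
Qed.

Lemma ds_step_search_success k x a x' a' :
  search_succeeds k x a -> ds_step k x a x' a' ->
  x' = search_point x a /\ a' = a.
Proof. by move=> ss; case=> [_|d nss|[nss _]] //; case: (nss ss). Qed.

(** The [uphalf] in the step size is one ahead of the [./2] in the iterate at
    odd indices: the step size has already been halved by the failed poll,
    while the iterate is halved only by the search that follows. *)
Lemma ds_run_closed_form (x alpha : nat -> R) : ds_run x alpha ->
  forall k, x k = 5 / 4 * 2 ^- k./2 /\ alpha k = 1 / 4 * 2 ^- (uphalf k).
Proof.
case=> x0 a0 step; elim=> [|k [xk ak]]; first by rewrite x0 a0 invr1 !mulr1.
have := step k; rewrite xk ak /= !uphalf_half.
have [oddk|evk] := boolP (odd k); rewrite ?add1n ?add0n /= => st.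
- have [-> ->] :=
    ds_step_search_success _ _ _ _ _ (search_succeeds_scaled _ _ oddk) st.
  by rewrite search_point_scaled.
- have [-> ->] :=
    ds_step_poll_failure _ _ _ _ _ (poll_fails_scaled _ _ evk) st.
  by rewrite exprS invfM; split=> //; field.
Qed.

Lemma closure_B1 : closure (@B1 R) `<=` `[-2, 0]%classic.
Proof.
have /closure_id -> : closed `[-2 : R, 0] by exact: itv_closed.
by apply: closure_subset => y; rewrite /B1 /= !in_itv/= => /andP[/ltW-> ->].
Qed.

Lemma cvg_exp2N_half : (2 : R) ^- k./2 @[k --> \oo] --> (0 : R).
Proof.
have half_cvg : k./2 @[k --> \oo] --> \oo.
  apply/cvgnyPge => n; exists n.*2 => // k /= nk.
  by rewrite -(doubleK n); exact: half_leq.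
have -> : (fun k => (2 : R) ^- k./2) = GRing.exp 2^-1 \o half.
  by apply/funext => k /=; rewrite exprVn.
apply: cvg_comp half_cvg _; apply: cvg_expr.
by rewrite ger0_norm ?invr_ge0// invf_lt1 ?ltr1n.
Qed.

End Run.

Theorem mainTheorem2 (R : realType) (x alpha : nat -> R)
    (run : ds_run x alpha) :
  (* K is the set of indices at which the poll step fails *)
  (forall k, poll_fails k (x k) (alpha k) <-> K k) /\
  (* (a) *)
  (forall K' : set nat, infinite_set K' -> K' `<=` K ->
     forall k, K' k ->
       closure B2 (x k) /\ interior B2 (x k + alpha k * d2)) /\
  (* (b) *)
  ((~ exists (K' : set nat) (B : set R),
        [/\ infinite_set K', K' `<=` K, B = B1 \/ B = B2 &
            forall k, K' k ->
              closure B (x k) /\ (~` closure B) (x k + alpha k * d1)]) /\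
   (forall k, ~ closure B1 (x k)) /\
   (forall q : nat,
      x (2 * q)%N + alpha (2 * q)%N * d1 = 2 ^- q /\
      B2 (x (2 * q)%N + alpha (2 * q)%N * d1))) /\
  (* (c) *)
  (forall K' : set nat, infinite_set K' -> K' `<=` K ->
     f (x k) @[k --> within K' \oo] --> (0 : R)) /\
  (0 : R) <> - 1 /\ f xstar = - 1 :> R.
Proof.
have run_eq := ds_run_closed_form _ _ run.
have B2E y : 0 < y < 2 -> B2 y by rewrite /B2 /= in_itv.
have x_gt0 k : 0 < x k.
  by rewrite (run_eq k).1; apply: mulr_gt0; [lra|exact: exp2N_gt0].
have xB2 k : B2 (x k).
  apply: B2E; rewrite x_gt0 (run_eq k).1 /=.
  by have := exp2N_le1 (R := R) k./2; lra.
have poll_right k : K k -> B2 (x k + alpha k * d2).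
  move=> evk; apply: B2E; rewrite (run_eq k).1 (run_eq k).2 uphalf_half.
  rewrite (negbTE evk) add0n /d2.
  have := exp2N_le1 (R := R) k./2; have := exp2N_gt0 (R := R) k./2.
  by move=> h0 h1; apply/andP; split; lra.
have poll_left k : K k -> x k + alpha k * d1 = 2 ^- k./2.
  move=> evk; rewrite (run_eq k).1 (run_eq k).2 uphalf_half.
  by rewrite (negbTE evk) add0n /d1; field.
have poll_leftB2 k : K k -> B2 (x k + alpha k * d1).
  move=> evk; rewrite poll_left//; apply: B2E; rewrite exp2N_gt0 /=.
  by have := exp2N_le1 (R := R) k./2; lra.
have xNB1 k : ~ closure B1 (x k).
  by move=> /closure_B1; rewrite /= in_itv/= => /andP[_]; rewrite leNgt x_gt0.
split; [|split; [|split; [split; [|split]|split; [|split]]]].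
- move=> k; rewrite /K /=; split=> [[nss _]|evk].
    apply/negP => oddk; apply: nss.
    rewrite (run_eq k).1 (run_eq k).2 uphalf_half oddk add1n.
    exact: search_succeeds_scaled.
  rewrite (run_eq k).1 (run_eq k).2 uphalf_half (negbTE evk) add0n.
  exact: poll_fails_scaled.
- move=> K' _ K'K k /K'K Kk; split; first exact: subset_closure.
  by rewrite /B2 interior_itv_bnd; exact: poll_right.
- case=> K' [B [/infinite_setN0[k K'k] K'K [->|->] leave]].
    by case: (leave k K'k) => /xNB1.
  by have [_ []] := leave k K'k; exact/subset_closure/poll_leftB2/K'K.
- exact: xNB1.
- move=> q; have Kq : K (2 * q)%N by rewrite /K /= mul2n odd_double.
  by split; [rewrite poll_left// mul2n doubleK|exact: poll_leftB2].
- move=> K' _ _; apply: cvg_within_filter.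
  have -> : (fun k => f (x k)) = (fun k => 121 / 128 * 2 ^- k./2).
    by apply/funext => k; rewrite (run_eq k).1 f_54_scaled.
  have := cvgM (cvg_cst (121 / 128 : R)) (@cvg_exp2N_half R).
  by rewrite mulr0; apply.
- lra.
- by rewrite /xstar f_nonpos// add0r expr1n; lra.
Qed.
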